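(* Let $X,W$ be real Banach spaces and let $Y$ be a constrained subspace of $X$, being the range of a norm-one linear projection $P$ on $X$. Suppose $Z_1$ is a closed linear subspace of $X$ such that $P(Z_1)\subseteq Z_1$, and let $Z_2=Z_1\cap Y$. If $W\hat{\otimes}_\varepsilon Z_1$ is a central subspace of $W\hat{\otimes}_\varepsilon X$, then $W\hat{\otimes}_\varepsilon Z_2$ is a central subspace of $W\hat{\otimes}_\varepsilon Y$.
   Context: All Banach spaces are real; ''subspace'' means closed linear subspace; $B_X(x,r)$ denotes the closed ball in $X$ with center $x$ and radius $r>0$. A subspace $Y$ of $X$ is constrained if it is the range of a norm-one linear projection on $X$. $W\hat{\otimes}_\varepsilon X$ denotes the injective tensor product, i.e. the completion of the algebraic tensor product $W\otimes X$ under the norm $\lambda\big(\sum_{i=1}^n w_i\otimes x_i\big)=\sup\{\|\sum_{i=1}^n\phi(w_i)x_i\|:\phi\in W^*,\ \|\phi\|=1\}$. For a subspace $Z$ of $X$, $W\hat{\otimes}_\varepsilon Z$ is regarded canonically as a subspace of $W\hat{\otimes}_\varepsilon X$. Central subspace: a subspace $Y$ of a Banach space $X$ is a central subspace of $X$ if every finite family of closed balls with centers in $Y$ that has nonempty intersection in $X$ also intersects in $Y$; i.e. for all $y_1,\dots,y_n\in Y$ and $r_1,\dots,r_n>0$, $\bigcap_{i=1}^n B_X(y_i,r_i)\neq\emptyset$ implies $Y\cap\bigcap_{i=1}^n B_X(y_i,r_i)\neq\emptyset$. *)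

(* Defs.v *)
From HB Require Import structures.
From mathcomp Require Import all_boot all_order all_algebra.
From mathcomp Require Import all_classical all_reals all_analysis.

Set Implicit Arguments.
Unset Strict Implicit.
Unset Printing Implicit Defensive.

Import Order.TTheory GRing.Theory Num.Theory.
Import numFieldNormedType.Exports.

Local Open Scope classical_set_scope.
Local Open Scope ring_scope.

Section BanachSpaces.
Context {R : realType}.
Implicit Types V : normedModType R.

Definition closed_subspace V (A : set V) : Prop :=
  [/\ A 0, forall (a : R) (x y : V), A x -> A y -> A (a *: x + y) & closed A].

(* Meaningful for continuous [f] only: [sup] is 0 on unbounded sets, so
   continuity is required separately wherever [opnorm] is used. *)
Definition opnorm V (V' : normedModType R) (f : V -> V') : R :=
  sup [set `|f x| | x in [set x | `|x| <= 1]].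

Definition norm_one_projection V (P : {linear V -> V}) : Prop :=
  [/\ continuous P, opnorm P = 1 & forall x, P (P x) = P x].

(* [A] is a central subspace of [B], where [B] is itself a closed subspace of
   [V] (possibly [setT]) seen as a Banach space: the closed balls of [B] are
   the traces on [B] of the closed balls of [V] centered in [B]. *)
Definition central_subspace V (A B : set V) : Prop :=
  [/\ closed_subspace A, closed_subspace B, A `<=` B &
      forall (n : nat) (y : 'I_n -> V) (r : 'I_n -> R),
        (forall i, A (y i)) -> (forall i, 0 < r i) ->
        B `&` \bigcap_(i in [set: 'I_n]) closed_ball (y i) (r i) !=set0 ->
        A `&` \bigcap_(i in [set: 'I_n]) closed_ball (y i) (r i) !=set0].

End BanachSpaces.

Section InjectiveTensorProduct.
Context {R : realType} {W X : completeNormedModType R}.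

(* The list [:: (w_1, x_1); ...; (w_n, x_n)] stands for the element
   w_1 (x) x_1 + ... + w_n (x) x_n of the algebraic tensor product. If W = 0
   there is no functional of norm one and the value is [sup set0 = 0]. *)
Definition injective_norm (u : seq (W * X)) : R :=
  sup [set `|\sum_(p <- u) (phi p.1 : R) *: p.2| |
       phi in [set phi : {linear W -> R^o} | continuous phi /\ opnorm phi = 1]].

Context {E : completeNormedModType R}.
Implicit Type t : {bilinear W -> X -> E}.

Definition tensor_sum t (u : seq (W * X)) : E := \sum_(p <- u) t p.1 p.2.

(* The closure in E of the copy of the algebraic tensor product of W and Z,
   i.e. the injective tensor product of W and Z as a subspace of that of W
   and X: the injective norm of an element of W (x) Z is the same computed in
   Z or in X. *)
Definition tensor_subspace t (Z : set X) : set E :=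
  closure [set tensor_sum t u | u in [set u | forall p, p \in u -> Z p.2]].

(* E, with (w, x) |-> t w x in the role of (w, x) |-> w (x) x, is the
   completion of the algebraic tensor product for the injective norm: E is
   complete, the linear map induced by the bilinear map t is isometric, and
   its range is dense. This determines (E, t) up to isometric isomorphism. *)
Definition is_injective_tensor t : Prop :=
  (forall u, `|tensor_sum t u| = injective_norm u) /\
  tensor_subspace t [set: X] = [set: E].

End InjectiveTensorProduct.

(* Main.v *)
(* The map id (x) P is a contraction for the injective norm, so it extends to a
   contraction Q of E. Q maps the tensor product of W and Z1 into that of W and
   Z2, because P maps Z1 into Z1 and has range Y, and it fixes the latter
   pointwise. Hence, if z in the tensor product of W and Z1 lies in balls
   centered in that of W and Z2, so does Q z. *)
Require Import Defs.
From HB Require Import structures.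
From mathcomp Require Import all_boot all_order all_algebra.
From mathcomp Require Import all_classical all_reals all_analysis.
Set Implicit Arguments.
Unset Strict Implicit.
Unset Printing Implicit Defensive.
Import Order.TTheory GRing.Theory Num.Theory.
Import numFieldNormedType.Exports.
Local Open Scope classical_set_scope.
Local Open Scope ring_scope.

Lemma closure_normP (R : realType) (V : normedModType R) (A : set V) (x : V) :
  closure A x <-> forall e : R, 0 < e -> exists2 a, A a & `|x - a| < e.
Proof.
split=> [Ax e e0|Ax B /nbhs_ballP[e /= e0 eB]].
  have [a [Aa xa]] := Ax _ (nbhsx_ballx x e e0).
  by exists a => //; rewrite -ball_normE in xa.
have [a Aa xa] := Ax e e0.
by exists a; split => //; apply: eB; rewrite -ball_normE.
Qed.

(* [q] is the value at [z] of the extension by continuity of f u |-> g u. *)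
Lemma contraction_extend (R : realType) (V : normedModType R)
    (U : completeNormedModType R) (T : Type) (f : T -> V) (g : T -> U) (z : V) :
  (forall u v, `|g u - g v| <= `|f u - f v|) -> closure (range f) z ->
  exists q, forall u, `|q - g u| <= `|z - f u|.
Proof.
move=> gf /closure_normP zf.
(* Choose [s] with [f (s n)] tending to [z]. The hypothesis on [g] makes [g (s n)] Cauchy, and [q]
   is its limit. *)
have /choice[s sP] (n : nat) : exists u, `|z - f u| < n.+1%:R^-1.
  have n0 : 0 < n.+1%:R^-1 :> R by rewrite invr_gt0.
  by have [_ [u _ <-] zu] := zf _ n0; exists u.
have /cauchy_cvgP/cvg_ex[/= q gq] : cauchy (g (s n) @[n --> \oo]).
  apply: cauchy_exP => e e0.
  have e2 : 0 < e / 2 by rewrite divr_gt0.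
  have [N _ NP] := near_infty_natSinv_lt (PosNum e2).
  exists (g (s N)); exists N => // n /= Nn.
  rewrite -ball_normE /=; apply: le_lt_trans (gf _ _) _.
  rewrite (splitr e) -(subrK z (f (s N))) -addrA.
  apply: le_lt_trans (ler_normD _ _) _.
  apply: ltrD; first rewrite distrC.
    by apply: lt_trans (sP N) (NP N _) => /=.
  exact: lt_trans (sP n) (NP n Nn).
(* Pass through one index [n] at which both [g (s n)] and [f (s n)] are within [e / 2] of their
   limits. *)
exists q => u; apply/ler_addgt0Pr => e e0.
have e2 : 0 < e / 2 by rewrite divr_gt0.
have [n [qn zn]] : exists n, `|q - g (s n)| < e / 2 /\ `|z - f (s n)| < e / 2.
  have Hn : \forall n \near \oo,
      `|q - g (s n)| < e / 2 /\ `|z - f (s n)| < e / 2.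
    near=> n; split.
      by near: n; move/cvgr_dist_lt: gq; apply.
    apply: lt_trans (sP n) _.
    by near: n; exact: near_infty_natSinv_lt (PosNum e2).
  by have [N _ NP] := Hn; exists N; apply: NP => /=.
have qu : `|q - g u| <= `|q - g (s n)| + `|g (s n) - g u|.
  by rewrite -{1}(subrK (g (s n)) q) -addrA ler_normD.
have zu : `|f (s n) - f u| <= `|z - f (s n)| + `|z - f u|.
  by rewrite -{1}(subrK z (f (s n))) -addrA [in leRHS](distrC z (f _)) ler_normD.
apply: le_trans qu _; rewrite (splitr e) addrCA lerD ?(ltW qn)//.
apply: le_trans (gf _ _) _; apply: le_trans zu _.
by rewrite [leRHS]addrC lerD2r ltW.
Unshelve. all: by end_near. Qed.

(** Continuity bounds [f] on the unit ball, so the [sup] in [opnorm] is a genuine upper bound;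
    nonzero vectors are then normalised. *)
Lemma opnorm_ubound (R : realType) (V V' : normedModType R)
    (f : {linear V -> V'}) (x : V) :
  continuous f -> `|f x| <= opnorm f * `|x|.
Proof.
move=> /linear_bounded_continuous/linear_boundedP/pinfty_ex_gt0[M M0 fM].
have fub : has_sup [set `|f x| | x in [set x | `|x| <= 1]].
  split; first by exists `|f 0|; exists 0 => //=; rewrite normr0.
  exists M => _ [y /= y1 <-]; apply: le_trans (fM y) _.
  by rewrite ler_piMr// ltW.
have [->|x0] := eqVneq x 0; first by rewrite linear0 !normr0 mulr0.
rewrite -ler_pdivrMr ?normr_gt0//.
have -> : `|f x| / `|x| = `|f (`|x|^-1 *: x)|.
  by rewrite linearZ normrZ normfV normr_id mulrC.
apply: ub_le_sup; first by case: fub.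
by exists (`|x|^-1 *: x) => //=; rewrite normrZ normfV normr_id mulVf ?normr_eq0.
Qed.

Section TensorMap.
Context {R : realType} {W X E : completeNormedModType R}.
Implicit Types (t : {bilinear W -> X -> E}) (u v : seq (W * X)).

Definition tensor_map (P : X -> X) u : seq (W * X) :=
  [seq (p.1, P p.2) | p <- u].

(** A list for [a] times the tensor of [u] plus that of [v]. The isometry in [is_injective_tensor]
    concerns single lists, so differences must be written as one list. *)
Definition tensor_lincomb (a : R) u v : seq (W * X) :=
  [seq (a *: p.1, p.2) | p <- u] ++ v.

Lemma tensor_sum_lincomb t a u v :
  tensor_sum t (tensor_lincomb a u v) =
  a *: tensor_sum t u + tensor_sum t v.
Proof.
rewrite /tensor_sum big_cat big_map /= scaler_sumr; congr (_ + _).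
by apply: eq_bigr => p _; rewrite linearZl_LR.
Qed.

Lemma tensor_map_lincomb P a u v :
  tensor_map P (tensor_lincomb a u v) =
  tensor_lincomb a (tensor_map P u) (tensor_map P v).
Proof. by rewrite /tensor_map /tensor_lincomb map_cat -!map_comp. Qed.

Lemma tensor_map_id P u :
  (forall p, p \in u -> P p.2 = p.2) -> tensor_map P u = u.
Proof.
by move=> Pu; rewrite -[RHS]map_id; apply/eq_in_map => -[w x] /Pu /= ->.
Qed.

(** For each functional [phi], linearity pulls [P] out of the sum, and [P] does not increase
    norms. *)
Lemma injective_norm_tensor_map (P : {linear X -> X}) u :
  continuous P -> opnorm P = 1 ->
  injective_norm (tensor_map P u) <= injective_norm u.
Proof.
move=> Pc P1; rewrite /injective_norm; set D := (D in image D _).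
rewrite -[in leRHS]/D.
(* Without functionals of norm one, both sides are [sup set0]. *)
have [->|/set0P[phi0 phi0D]] := eqVneq D set0; first by rewrite !image_set0.
apply: ge_sup; first by eexists; exists phi0.
move=> _ [phi phi1 <-].
apply: (@le_trans _ _ `|\sum_(p <- u) (phi p.1 : R) *: p.2|).
  rewrite big_map /=.
  have -> : \sum_(p <- u) (phi p.1 : R) *: P p.2 =
            P (\sum_(p <- u) (phi p.1 : R) *: p.2).
    by rewrite linear_sum; apply: eq_bigr => p _; rewrite linearZ.
  by apply: le_trans (opnorm_ubound _ Pc) _; rewrite P1 mul1r.
apply: ub_le_sup; last by exists phi.
(* The projective-type bound shows that the right-hand supremum is finite. *)
exists (\sum_(p <- u) `|p.1| * `|p.2|) => _ [psi [psic psi1] <-].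
apply: le_trans (ler_norm_sum _ _ _) _; apply: ler_sum => p _.
rewrite normrZ ler_wpM2r//.
by apply: le_trans (opnorm_ubound _ psic) _; rewrite psi1 mul1r.
Qed.

Lemma tensor_map_contraction t (P : {linear X -> X}) u v :
  is_injective_tensor t -> continuous P -> opnorm P = 1 ->
  `|tensor_sum t (tensor_map P u) - tensor_sum t (tensor_map P v)| <=
  `|tensor_sum t u - tensor_sum t v|.
Proof.
move=> [tn _] Pc P1.
have subE u' v' : tensor_sum t u' - tensor_sum t v' =
    tensor_sum t (tensor_lincomb (- 1) v' u').
  by rewrite tensor_sum_lincomb scaleN1r addrC.
rewrite !subE -tensor_map_lincomb !tn.
exact: injective_norm_tensor_map.
Qed.

Lemma tensor_subspaceS t (Z Z' : set X) :
  Z `<=` Z' -> tensor_subspace t Z `<=` tensor_subspace t Z'.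
Proof.
by move=> ZZ'; apply: closureS => _ [u uZ <-]; exists u => // p /uZ /ZZ'.
Qed.

Lemma closed_tensor_subspace t (Z : set X) :
  closed_subspace (tensor_subspace t Z).
Proof.
split; last exact: closed_closure.
  by apply: subset_closure; exists [::] => //; rewrite /tensor_sum big_nil.
move=> a x y /closure_normP xZ /closure_normP yZ; apply/closure_normP => e e0.
(* Adding 1 keeps the divisor positive when [a] is 0. *)
have a0 : 0 < `|a| + 1 by rewrite ltr_wpDl.
have e2 : 0 < e / 2 by rewrite divr_gt0.
have [_ [u uZ <-] xu] := xZ _ (divr_gt0 e2 a0).
have [_ [v vZ <-] yv] := yZ _ e2.
exists (tensor_sum t (tensor_lincomb a u v)).
  exists (tensor_lincomb a u v) => // p; rewrite mem_cat => /orP[|/vZ//].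
  by move=> /mapP[q /uZ qZ ->].
rewrite tensor_sum_lincomb opprD addrACA -scalerBr (splitr e).
apply: le_lt_trans (ler_normD _ _) _; rewrite ler_ltD// normrZ.
rewrite ltr_pdivlMr// in xu; apply: le_trans (ltW xu).
by rewrite mulrC ler_wpM2l// lerDl.
Qed.

End TensorMap.

Theorem theorem2p12 (R : realType) (W X : completeNormedModType R)
    (E : completeNormedModType R) (t : {bilinear W -> X -> E})
    (ht : is_injective_tensor t)
    (Y : set X) (P : {linear X -> X})
    (hP : norm_one_projection P) (hY : Y = range P)
    (Z1 : set X) (hZ1 : closed_subspace Z1) (hPZ1 : P @` Z1 `<=` Z1)
    (Z2 : set X) (hZ2 : Z2 = Z1 `&` Y) :
  central_subspace (tensor_subspace t Z1) [set: E] ->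
  central_subspace (tensor_subspace t Z2) (tensor_subspace t Y).
Proof.
case: hP => Pc P1 PP [_ _ _ Z1central].
have Z21 : Z2 `<=` Z1 by rewrite hZ2; exact: subIsetl.
have PZ2 x : Z2 x -> P x = x by rewrite hZ2 hY => -[_ [y _ <-]].
split; [exact: closed_tensor_subspace | exact: closed_tensor_subspace | |].
  by apply: tensor_subspaceS; rewrite hZ2; exact: subIsetr.
move=> n y r yZ2 r0 [x [_ xB]].
have [||z [zZ1 zB]] := Z1central n y r _ r0.
- by move=> i; exact: tensor_subspaceS (yZ2 i).
- by exists x.
(* [q] plays the role of Q z. Its defining estimate is kept for all lists [u], so that [u] can be
   taken over [Z1] to locate [q] and over [Z2] to compare it with the centers. *)
have [q qP] : exists q, forall u,
    `|q - tensor_sum t (tensor_map P u)| <= `|z - tensor_sum t u|.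
  apply: contraction_extend => [u v|].
    exact: tensor_map_contraction.
  by apply: closureS zZ1 => _ [u _ <-]; exists u.
exists q; split.
  apply/closure_normP => e e0.
  have [_ [u uZ1 <-] zu] := (closure_normP _ _).1 zZ1 _ e0.
  exists (tensor_sum t (tensor_map P u)); last exact: le_lt_trans (qP u) zu.
  exists (tensor_map P u) => // _ /mapP[p /uZ1 pZ1 ->] /=.
  by rewrite hZ2 hY; split; [apply: hPZ1; exists p.2|exists p.2].
(* Approximate the center [y i] within [e / 2] by the tensor of a list [u] over [Z2]. Since
   [tensor_map P] fixes [u], [qP] bounds the distance from [q] to that tensor by the distance from
   [z]. Two triangle inequalities cost [e / 2] each. *)
move=> i _; have := zB i I; rewrite !closed_ballE// /closed_ball_ /=.
apply: le_trans; apply/ler_addgt0Pr => e e0.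
have e2 : 0 < e / 2 by rewrite divr_gt0.
have [_ [u uZ2 <-] yu] := (closure_normP _ _).1 (yZ2 i) _ e2.
have Pu : tensor_map P u = u by apply: tensor_map_id => p /uZ2/PZ2.
have := qP u; rewrite Pu => qu.
have yq : `|y i - q| <= `|y i - tensor_sum t u| + `|q - tensor_sum t u|.
  by rewrite -{1}(subrK (tensor_sum t u) (y i)) -addrA
    [in leRHS](distrC q) ler_normD.
have zu : `|z - tensor_sum t u| <= `|y i - z| + `|y i - tensor_sum t u|.
  by rewrite -{1}(subrK (y i) z) -addrA [in leRHS](distrC (y i) z) ler_normD.
apply: le_trans yq _; rewrite (splitr e) addrCA lerD ?(ltW yu)//.
apply: le_trans qu _; apply: le_trans zu _.
by rewrite lerD2l ltW.
Qed.
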